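(* Let $P$ and $Q$ be any two probability distributions on an alphabet $\mathcal{Z}$ and let $E\subseteq\mathcal{Z}$ be any event. If $P(E)\le 1/2$, then $$P(E)\le 1-e^{-h(Q(E))-D(Q\|P)}.$$ In particular, for any joint distribution $P_{XY}$ on $\mathcal{X}\times\mathcal{Y}$ with marginals $P_X$, $P_Y$ and any event $E\subseteq\mathcal{X}\times\mathcal{Y}$ with $P_{XY}(E)\le 1/2$, $$P_{XY}(E)\le 1-e^{-h(P_XP_Y(E))-L(X;Y)},$$ where $L(X;Y):=D(P_XP_Y\|P_{XY})$ is the lautum information.
   Context: Logarithms are natural. $D(\cdot\|\cdot)$ is the Kullback–Leibler divergence (in nats). $h(q)=-q\log q-(1-q)\log(1-q)$ is the binary entropy function in nats (with $0\log0=0$). $P_XP_Y$ denotes the product of the marginals of $P_{XY}$. *)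

(* Defs.v *)
From HB Require Import structures.
From mathcomp Require Import all_boot all_order all_algebra.
From mathcomp Require Import all_classical all_reals all_analysis.

Set Implicit Arguments.
Unset Strict Implicit.
Unset Printing Implicit Defensive.
Import Order.TTheory GRing.Theory Num.Theory.

Local Open Scope classical_set_scope.
Local Open Scope ring_scope.

(* [ln 0 = 0] here, and both summands vanish at the endpoints [q = 0, 1]
   anyway, so the convention [0 log 0 = 0] holds. *)
Definition binary_entropy (R : realType) (q : R) : R :=
  - (q * ln q) - (1 - q) * ln (1 - q).

(* D(Q || P) in nats, for probabilities on an arbitrary measurable space; on a
   discrete space this is [\sum_z Q z * ln (Q z / P z)]. The derivative dQ/dP
   is determined P-almost everywhere, hence Q-almost everywhere, and is
   positive Q-almost everywhere; the negative part of log(dQ/dP) is always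
   Q-integrable, so the integral is never of the form +oo - oo. *)
Definition kl_div d (Z : measurableType d) (R : realType)
    (Q P : probability Z R) : \bar R :=
  if `[< Q `<< P >] then
    (\int[Q]_z lne (Radon_Nikodym (charge_of_finite_measure Q) P z))%E
  else +oo%E.

Section joint.
Context dX dY (X : measurableType dX) (Y : measurableType dY) (R : realType).

HB.instance Definition _ :=
  @isMeasurableFun.Build _ _ (X * Y)%type X fst measurable_fst.
HB.instance Definition _ :=
  @isMeasurableFun.Build _ _ (X * Y)%type Y snd measurable_snd.

Definition marginalX (PXY : probability (X * Y)%type R) : probability X R :=
  distribution PXY (fst : {mfun (X * Y)%type >-> X}).

Definition marginalY (PXY : probability (X * Y)%type R) : probability Y R :=
  distribution PXY (snd : {mfun (X * Y)%type >-> Y}).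

Definition prod_marginals (PXY : probability (X * Y)%type R) :
    probability (X * Y)%type R :=
  (marginalX PXY \x marginalY PXY)%E.

Definition lautum_information (PXY : probability (X * Y)%type R) : \bar R :=
  kl_div (prod_marginals PXY) PXY.

End joint.

(* Main.v *)
(* For every w >= 0 that is Q-a.e. positive, the tangent bound
   ln f >= ln w + 1 - w / f, applied to f = dQ/dP and integrated against Q, gives
   D(Q || P) >= E_Q[ln w] + 1 - E_P[w].  With p = P(E) and q = Q(E), take
   w = q / (1 - p) on E and w = (1 - q) / (1 - p) off E.  Since p <= 1 - p,
   E_P[w] <= 1, and E_Q[ln w] = - h(q) - ln (1 - p).  The data-processing choice
   q / p on E would need a separate treatment of p = 0. *)
Require Import Defs.
From mathcomp Require Import all_boot all_order all_algebra.
From mathcomp Require Import all_classical all_reals all_analysis.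
From mathcomp Require Import measurable_realfun.
From mathcomp Require Import ring lra.

Local Open Scope classical_set_scope.
Local Open Scope ring_scope.
Local Open Scope ereal_scope.

Import Order.TTheory GRing.Theory Num.Theory.

Lemma measurable_lne_EFin {d} {T : measurableType d} {R : realType}
    (f : T -> R) :
  measurable_fun [set: T] f ->
  measurable_fun [set: T] (fun x => lne (f x)%:E).
Proof.
move=> mf; rewrite /lne; apply: measurable_fun_ifT.
- exact: measurable_fun_ler.
- exact: measurable_cst.
- by apply/measurable_EFinP; apply: measurableT_comp mf; exact: measurable_ln.
Qed.

(** Positive and negative parts are compared separately. The integral of [h] may be [+oo], as
    happens when the divergence is infinite. *)
Lemma ae_integrable_le_integral {d} {T : measurableType d} {R : realType}
    (mu : {measure set T -> \bar R}) (g h : T -> \bar R) :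
  mu.-integrable [set: T] g -> measurable_fun [set: T] h ->
  {ae mu, forall x, g x <= h x} ->
  \int[mu]_x g x <= \int[mu]_x h x.
Proof.
move=> ig mh gh; have mg := measurable_int _ ig.
rewrite (integralE _ _ g) (integralE _ _ h) leeB//;
  apply: ae_ge0_le_integral => //.
- exact: measurable_funepos.
- exact: measurable_funepos.
- apply: filterS gh => x gh _.
  by rewrite !funeposE ge_max !le_max gh/= lexx orbT.
- exact: measurable_funeneg.
- exact: measurable_funeneg.
- apply: filterS gh => x gh _.
  by rewrite !funenegE ge_max !le_max leeN2 gh/= lexx orbT.
Qed.

(** This is [ln t <= t - 1] at [t = w / x]. *)
Lemma ln_ge_tangent {R : realType} (x w : R) : (0 < x)%R -> (0 < w)%R ->
  (ln w + 1 - w / x <= ln x)%R.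
Proof.
move=> x0 w0; have := @le_ln1Dx R (w / x - 1)%R.
rewrite (addrC 1%R) subrK ln_div ?posrE// ltrBrDr addNr divr_gt0// => /(_ isT).
lra.
Qed.

(** Here [w] acts as a guess for dQ/dP. Positivity Q-a.e. matters because [ln 0 = 0]: the tangent
    bound can fail where [w] vanishes. *)
Lemma kl_div_lower_bound {d} {Z : measurableType d} {R : realType}
    (P Q : probability Z R) (w : Z -> R) :
  (forall z, (0 <= w z)%R) ->
  P.-integrable [set: Z] (fun z => (w z)%:E) ->
  {ae Q, forall z, (0 < w z)%R} ->
  Q.-integrable [set: Z] (fun z => (ln (w z))%:E) ->
  \int[Q]_z (ln (w z))%:E + 1 - \int[P]_z (w z)%:E <= kl_div Q P.
Proof.
move=> w0 iw wQ ilnw; rewrite /kl_div; case: asboolP => [QP|_]; last exact: leey.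
(* This version of dQ/dP is finite and nonnegative everywhere; it is matched with the version inside
   [kl_div] only at [Qf]. *)
pose f := Radon_Nikodym_SigmaFinite.f Q P.
have f0 : forall z, 0 <= f z by exact: Radon_Nikodym_SigmaFinite.f_ge0.
have ffin : forall z, f z \is a fin_num.
  exact: Radon_Nikodym_SigmaFinite.f_fin_num.
have mf : measurable_fun [set: Z] f.
  exact: measurable_int (Radon_Nikodym_SigmaFinite.f_integrable QP).
have mw : measurable_fun [set: Z] w.
  by apply/measurable_EFinP; exact: measurable_int iw.
pose r z := fine (f z).
have r0 z : (0 <= r z)%R by exact: fine_ge0.
have mr : measurable_fun [set: Z] r by exact: measurableT_comp mf.
have frE z : f z = (r z)%:E by rewrite fineK.
(* [u z = 0] where [r z = 0]; only there is [u * f <= w] possibly strict. *)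
pose u z := (w z / r z)%R.
have u0 z : (0 <= u z)%R by rewrite divr_ge0.
have mu : measurable_fun [set: Z] u.
  apply: measurable_funM => //.
  rewrite (_ : (fun z => _) = (fun z => r z `^ (-1))%R); last first.
    by apply/funext => z; rewrite powR_inv1.
  exact: (measurableT_comp (measurable_powR (-1)%R) mr).
(* Change of variables turns E_Q[u] into E_P[u f]. Finiteness of E_P[w] then makes [u]
   Q-integrable. *)
have uw : \int[Q]_z (u z)%:E <= \int[P]_z (w z)%:E.
  rewrite -(Radon_Nikodym_SigmaFinite.change_of_variables QP)//; last first.
    exact/measurable_EFinP.
  apply: ge0_le_integral => //.
  - by move=> z _; rewrite mule_ge0// lee_fin.
  - by apply: emeasurable_funM => //; exact/measurable_EFinP.
  - exact: measurable_int iw.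
  - move=> z _; rewrite -/f frE -EFinM lee_fin /u.
    have [->|rn0] := eqVneq (r z) 0%R; first by rewrite mulr0.
    by rewrite divfK.
have iwfin : \int[P]_z (w z)%:E \is a fin_num by exact: integrable_fin_num.
have iu : Q.-integrable [set: Z] (fun z => (u z)%:E).
  apply/integrableP; split; first exact/measurable_EFinP.
  under eq_integral do rewrite gee0_abs ?lee_fin//.
  by rewrite (le_lt_trans uw)// ltey_eq iwfin.
have i1 : Q.-integrable [set: Z] (fun z => 1%:E).
  exact: finite_measure_integrable_cst.
have ig : Q.-integrable [set: Z] (fun z => (ln (w z))%:E + 1%:E).
  exact: integrableD.
(* First E_P[w] is traded for E_Q[u] by [uw]; what remains is a Q-a.e. comparison of integrands. *)
apply: (@le_trans _ _ (\int[Q]_z ((ln (w z))%:E + 1%:E - (u z)%:E))).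
  rewrite integralB// integralD// integral_cst//.
  rewrite [X in _ <= _ + X - _](_ : _ = 1); last first.
    by rewrite mul1e; exact: probability_setT.
  by rewrite leeB.
have mr0 : measurable [set z | r z = 0%R].
  rewrite -[X in measurable X]setTI.
  exact: (mr measurableT _ (measurable_set1 0%R)).
(* The zero set of the density has Q-mass equal to the P-integral of [f] over it, which is 0. *)
have Qr : {ae Q, forall z, (0 < r z)%R}.
  exists [set z | r z = 0%R]; split => //.
  - rewrite (Radon_Nikodym_SigmaFinite.f_integral QP)//.
    by rewrite integral0_eq// => z /= rz; rewrite -/f frE rz.
  - by move=> z /= /negP; rewrite -leNgt => rz; apply/eqP; rewrite eq_le rz r0.
(* Two densities agree P-a.e.; domination of Q by P carries this over to Q. *)
have Qf : ae_eq Q [set: Z] f (Radon_Nikodym (charge_of_finite_measure Q) P).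
  apply: (null_dominates_ae_eq _ QP) => //.
  exact: ae_eq_Radon_Nikodym_SigmaFinite.
set g := Radon_Nikodym _ _.
have gE z : g z = (fine (g z))%:E by rewrite fineK// Radon_Nikodym_fin_num.
have mg : measurable_fun [set: Z] (fun z => fine (g z)).
  apply: measurableT_comp => //; apply: (measurable_int P).
  exact: Radon_Nikodym_integrable.
apply: ae_integrable_le_integral.
- exact: integrableB.
- by under eq_fun do rewrite gE; exact: measurable_lne_EFin.
- apply: filterS3 wQ Qr Qf => z wz rz /(_ I); rewrite -/g => <-.
  by rewrite frE lne_EFin// lee_fin ln_ge_tangent.
Qed.

(** Serves for both E_P[w] and E_Q[ln w], since the chosen [w] takes one value on the event and one
    off it. *)
Lemma integral_step {d} {T : measurableType d} {R : realType}
    (mu : probability T R) (A : set T) (a b : R) : measurable A ->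
  mu.-integrable [set: T] (fun x => (if x \in A then a else b)%:E) /\
  \int[mu]_x (if x \in A then a else b)%:E =
  (a * fine (mu A) + b * (1 - fine (mu A)))%:E.
Proof.
move=> mA; have mAC := measurableC mA.
have iA : mu.-integrable [set: T] (fun x => a%:E * (\1_A x)%:E).
  by apply: integrableZl => //; exact: integrable_indic.
have iAC : mu.-integrable [set: T] (fun x => b%:E * (\1_(~` A) x)%:E).
  by apply: integrableZl => //; exact: integrable_indic.
have E : (fun x => (if x \in A then a else b)%:E) =
    (fun x => a%:E * (\1_A x)%:E + b%:E * (\1_(~` A) x)%:E).
  apply/funext => x; rewrite !indicE in_setC.
  by case: (x \in A); rewrite /= ?mule1 ?mule0 ?adde0 ?add0e.
rewrite E; split; first exact: integrableD.
rewrite integralD// !integralZl//; [|exact: integrable_indic..].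
rewrite !integral_indic// !setIT.
rewrite [X in _ * X + _](_ : _ = (fine (mu A))%:E); last first.
  by rewrite fineK// fin_num_measure.
rewrite [X in _ + _ * X](_ : _ = (1 - fine (mu A))%:E) //.
by rewrite -[LHS]/(mu (~` A)) probability_setC// EFinB fineK// fin_num_measure.
Qed.

(** The target bound solved for the divergence, so that the exponential enters only at the end. *)
Lemma kl_div_ge_event {d} {Z : measurableType d} {R : realType}
    (P Q : probability Z R) (E : set Z) :
  measurable E -> P E <= (2^-1)%:E ->
  (- ln (1 - fine (P E)) - binary_entropy (fine (Q E)))%:E <= kl_div Q P.
Proof.
move=> mE; set p := fine (P E); set q := fine (Q E).
have PE : P E = p%:E by rewrite fineK// fin_num_measure.
have QE : Q E = q%:E by rewrite fineK// fin_num_measure.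
have p0 : (0 <= p)%R by exact: fine_ge0.
have q0 : (0 <= q)%R by exact: fine_ge0.
have q1 : (q <= 1)%R by rewrite -lee_fin -QE probability_le1.
rewrite PE lee_fin => p2.
have p1 : (0 < 1 - p)%R by lra.
pose a := (q / (1 - p))%R; pose b := ((1 - q) / (1 - p))%R.
have a0 : (0 <= a)%R by rewrite divr_ge0// ltW.
have b0 : (0 <= b)%R by apply: divr_ge0; lra.
pose w z : R := if z \in E then a else b.
have lnw : (fun z => (ln (w z))%:E) =
    (fun z => (if z \in E then ln a else ln b)%:E).
  by apply/funext => z; rewrite /w; case: ifP.
have [iw intw] := integral_step P E a b mE.
have [ilnw intlnw] := integral_step Q E (ln a) (ln b) mE.
(* Applied at [q] and [1 - q]; at [x = 0] the factor [x] kills both sides. *)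
have xlnx x : (0 <= x)%R -> (ln (x / (1 - p)) * x = x * ln x - x * ln (1 - p))%R.
  rewrite le_eqVlt => /predU1P[<-|x0]; first by rewrite !mulr0 !mul0r subr0.
  by rewrite ln_div ?posrE//; ring.
apply: le_trans (kl_div_lower_bound P Q w _ iw _ _); last first.
- by rewrite lnw.
(* The value of [w] on [E] or on its complement is 0 only if that set is Q-null. *)
- have pos (A : set Z) x : measurable A -> Q A = x%:E -> (0 <= x)%R ->
      {ae Q, forall z, z \in A -> (0 < x / (1 - p))%R}.
    move=> mA QA; rewrite le_eqVlt => /predU1P[x0|x0]; last first.
      by apply: aeW => z _; exact: divr_gt0.
    exists A; split=> //; first by rewrite QA -x0.
    by move=> z /= /not_implyP[zA _]; exact: set_mem.
  have QEC : Q (~` E) = (1 - q)%:E by rewrite probability_setC// QE.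
  have q1' : (0 <= 1 - q)%R by lra.
  apply: filterS2 (pos _ _ mE QE q0) (pos _ _ (measurableC mE) QEC q1') => z.
  by rewrite /w in_setC; case: ifP => _ ? ?; auto.
- by move=> z; rewrite /w; case: ifP.
rewrite lnw intlnw intw lee_fin -/p -/q !xlnx ?subr_ge0//.
have -> : (b * (1 - p) = 1 - q)%R by rewrite divfK ?gt_eqF.
(* Here P(E) <= 1/2 enters, as [p / (1 - p) <= 1]; hence E_P[w] <= q + (1 - q) = 1. *)
have ap : (a * p <= q)%R.
  by rewrite /a mulrAC ler_pdivrMr// ler_wpM2l//; lra.
rewrite /binary_entropy; lra.
Qed.

Theorem theorem1 (R : realType) :
  (forall (d : measure_display) (Z : measurableType d)
          (P Q : probability Z R) (E : set Z),
      measurable E ->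
      P E <= (2^-1)%:E ->
      P E <= 1 - expeR (- (binary_entropy (fine (Q E)))%:E - kl_div Q P))
  /\
  (forall (dX dY : measure_display)
          (X : measurableType dX) (Y : measurableType dY)
          (PXY : probability (X * Y)%type R) (E : set (X * Y)),
      measurable E ->
      PXY E <= (2^-1)%:E ->
      PXY E <= 1 - expeR (- (binary_entropy (fine (prod_marginals PXY E)))%:E
                          - lautum_information PXY)).
Proof.
suff main : forall (d : measure_display) (Z : measurableType d)
    (P Q : probability Z R) (E : set Z), measurable E -> P E <= (2^-1)%:E ->
    P E <= 1 - expeR (- (binary_entropy (fine (Q E)))%:E - kl_div Q P).
  by split=> [|dX dY X Y PXY E]; exact: main.
move=> d Z P Q E mE PE2; have := kl_div_ge_event P Q E mE PE2.
have : P E \is a fin_num by rewrite fin_num_measure.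
move: PE2; case: (P E) => // p; rewrite lee_fin /= => p2 _ D_ge.
have p1 : (0 < 1 - p)%R by lra.
(* At [+oo] the exponential is 0 and the claim is [p <= 1]; [-oo] contradicts the lower bound. *)
case: (kl_div Q P) D_ge => [D| _|//]; last by rewrite /= sube0 lee_fin; lra.
rewrite lee_fin => D_ge.
have : (expR (- binary_entropy (fine (Q E)) - D) <= 1 - p)%R.
  by rewrite -[leRHS]lnK ?posrE// ler_expR; lra.
rewrite -EFinN -EFinB /= lee_fin; lra.
Qed.
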